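(* Let $n_1,n_2,n_3\in\mathbb{N}$. If $\alpha(n_1+n_2)=\alpha(n_1)+\alpha(n_2)$, then there exist $\varepsilon,\varepsilon_1,\varepsilon_2\in\{0,1\}$ with $\varepsilon+\varepsilon_1+\varepsilon_2\le 1$ such that $n_1+n_2-\varepsilon$, $n_1+1+\varepsilon_1$ and $n_2+1+\varepsilon_2$ are all Ramsey numbers. Furthermore, if $n_i\ge 3$ for $i=1,2,3$, then $$\alpha(n_1+n_2+n_3)<\alpha(n_1)+\alpha(n_2)+\alpha(n_3).$$
   Context: $R(3,m)$ is the Ramsey number: the smallest $N$ such that every graph on $N$ vertices contains a triangle or a stable set of size $m$. A ''Ramsey number'' means a number of the form $R(3,m)$ for some $m\in\mathbb{N}$. For $n\in\mathbb{N}$, $\alpha(n)$ is the minimum, over triangle-free graphs $G$ on $n$ vertices, of the maximum size of a stable set of $G$; equivalently, $R(3,\alpha(n))\le n<R(3,\alpha(n)+1)$. *)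

(* Defs.v *)
From HB Require Import structures.
From mathcomp Require Import all_boot zify.

Set Implicit Arguments.
Unset Strict Implicit.
Unset Printing Implicit Defensive.

(* Adjacency is stored as a finite function so that the simple graphs on [T]   *)
(* themselves form a finite type, over which a minimum can be taken.           *)
Record graph (T : finType) := Graph {
  graph_adj : {ffun T * T -> bool};
  graph_axiom : [forall x, ~~ graph_adj (x, x)] &&
                [forall x, forall y, graph_adj (x, y) == graph_adj (y, x)]
}.

HB.instance Definition _ (T : finType) := [isSub for @graph_adj T].
HB.instance Definition _ (T : finType) := [Finite of graph T by <:].

Section GraphNotions.
Variables (T : finType) (G : graph T).

Definition adj : rel T := fun x y => graph_adj G (x, y).

Definition has_triangle : bool :=
  [exists x, exists y, exists z, [&& adj x y, adj y z & adj x z]].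

Definition triangle_free : bool := ~~ has_triangle.

Definition stable (S : {set T}) : bool :=
  [forall x in S, forall y in S, ~~ adj x y].

Definition max_stable : nat := \max_(S : {set T} | stable S) #|S|.

Lemma adj_irrefl x : adj x x = false.
Proof. by apply/negbTE; have /andP[/forallP /(_ x)] := graph_axiom G. Qed.

Lemma adj_sym x y : adj x y = adj y x.
Proof.
by have /andP[_ /forallP /(_ x) /forallP /(_ y) /eqP] := graph_axiom G.
Qed.

Lemma stableP (S : {set T}) :
  reflect {in S &, forall x y, adj x y = false} (stable S).
Proof.
apply: (iffP forall_inP) => [h x y xS yS|h x xS].
  by apply/negbTE; move/forall_inP: (h x xS); apply.
by apply/forall_inP => y yS; rewrite h.
Qed.

Lemma stable_sub (A B : {set T}) : A \subset B -> stable B -> stable A.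
Proof.
by move=> /subsetP sAB /stableP h; apply/stableP => x y /sAB xB /sAB; apply: h.
Qed.

Lemma stable_nbhd (A : {set T}) x :
  triangle_free -> stable [set y in A | adj x y].
Proof.
move=> tf; apply/stableP => y z; rewrite !inE => /andP[_ xy] /andP[_ xz].
apply/negbTE; apply: contra tf => yz.
by apply/existsP; exists x; apply/existsP; exists y; apply/existsP; exists z;
   rewrite xy yz xz.
Qed.

Lemma greedy_stable m k (A : {set T}) : triangle_free -> k * m <= #|A| ->
  exists S : {set T}, [/\ S \subset A, stable S & (#|S| == k) || (#|S| == m)].
Proof.
move=> tf; elim: k A => [|k IH] A hA.
  exists set0; split; rewrite ?sub0set ?cards0 //.
  by apply/stableP => x y; rewrite inE.
case: (posnP m) => [->|m_gt0].
  exists set0; split; rewrite ?sub0set ?cards0 ?eqxx ?orbT //.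
  by apply/stableP => x y; rewrite inE.
have /card_gt0P[x xA] : 0 < #|A| by move: hA; rewrite mulSn; lia.
pose N := [set y in A | adj x y].
have stN : stable N by exact: stable_nbhd.
have sNA : N \subset A by apply/subsetP => y; rewrite inE => /andP[].
case: (leqP m #|N|) => [le_mN|lt_Nm].
  exists [set y in take m (enum N)].
  have sN : [set y in take m (enum N)] \subset N.
    by apply/subsetP => y; rewrite inE => /mem_take; rewrite mem_enum.
  split; [exact: subset_trans sN sNA | exact: stable_sub sN stN |].
  rewrite cardsE (card_uniqP _) ?take_uniq ?enum_uniq //.
  by rewrite size_takel ?eqxx ?orbT // -cardE.
pose B := A :\: (x |: N).
have xN : x \notin N by rewrite inE adj_irrefl andbF.
have hB : k * m <= #|B|.
  have sxNA : x |: N \subset A by rewrite subUset sub1set xA.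
  have := cardsD A (x |: N).
  rewrite (setIidPr sxNA) cardsU1 xN -/B => ->.
  by move: hA; rewrite mulSn; lia.
have [S [sSB stS cS]] := IH B hB.
case/orP: cS => cS; last first.
  by exists S; split; rewrite ?cS ?orbT // (subset_trans sSB) ?subsetDl.
have hS y : y \in S -> y \in A /\ adj x y = false.
  move=> /(subsetP sSB); rewrite !inE => /andP[h yA]; split=> //.
  by apply/negbTE; move: h; rewrite yA negb_or => /andP[].
exists (x |: S); split.
- by rewrite subUset sub1set xA (subset_trans sSB) ?subsetDl.
- apply/stableP => y z; rewrite !inE => /orP[/eqP->|yS] /orP[/eqP->|zS].
  + exact: adj_irrefl.
  + by case: (hS z zS).
  + by rewrite adj_sym; case: (hS y yS).
  + by move/stableP: stS; apply.
rewrite cardsU1 (eqP cS).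
have -> : x \notin S.
  by apply/negP => /(subsetP sSB); rewrite !inE eqxx.
by rewrite add1n eqxx.
Qed.

End GraphNotions.

Definition ramsey3_prop (m N : nat) : bool :=
  [forall G : graph 'I_N,
     has_triangle G || [exists S : {set 'I_N}, stable G S && (#|S| == m)]].

Lemma ramsey3_ex (m : nat) : exists N, ramsey3_prop m N.
Proof.
exists (m * m); apply/forallP => G.
case: (boolP (has_triangle G)) => //= tf.
have [|S [_ stS /orP cS]] := @greedy_stable _ G m m [set: 'I_(m * m)] tf.
  by rewrite cardsT card_ord.
by apply/existsP; exists S; rewrite stS; case: cS.
Qed.

Definition R3 (m : nat) : nat := ex_minn (ramsey3_ex m).

Definition is_ramsey_number (N : nat) : Prop := exists2 m, 0 < m & N = R3 m.

(* The default value [n] of the minimum is harmless: it bounds every           *)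
(* [max_stable G] and is attained by the edgeless graph; see [alphaP].         *)
Definition alpha (n : nat) : nat :=
  \big[minn/n]_(G : graph 'I_n | triangle_free G) max_stable G.

Lemma edgeless_axiom (T : finType) (e := [ffun _ : T * T => false]) :
  [forall x, ~~ e (x, x)] && [forall x, forall y, e (x, y) == e (y, x)].
Proof.
apply/andP; split; apply/forallP => x; first by rewrite ffunE.
by apply/forallP => y; rewrite !ffunE.
Qed.

Definition edgeless (T : finType) : graph T := Graph (edgeless_axiom T).

Lemma edgeless_triangle_free (T : finType) : triangle_free (edgeless T).
Proof.
by apply/existsP => -[x /existsP[y /existsP[z]]]; rewrite /adj /= !ffunE.
Qed.

Lemma max_stable_edgeless (T : finType) : max_stable (edgeless T) = #|T|.
Proof.
apply/eqP; rewrite eqn_leq; apply/andP; split.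
  by apply/bigmax_leqP => S _; exact: max_card.
rewrite -cardsT; apply: (@leq_bigmax_cond _ _ (fun S : {set T} => #|S|)).
by apply/stableP => x y _ _; rewrite /adj /= ffunE.
Qed.

Lemma alphaP (n : nat) :
  (exists2 G : graph 'I_n, triangle_free G & max_stable G = alpha n) /\
  (forall G : graph 'I_n, triangle_free G -> alpha n <= max_stable G).
Proof.
split; last first.
  move=> G tf; rewrite /alpha.
  elim: (index_enum _) (mem_index_enum G) => [//|H r IH].
  rewrite inE big_cons => /orP[/eqP<-|/IH le_r]; first by rewrite tf geq_minl.
  by case: ifP => // _; rewrite geq_min le_r orbT.
rewrite /alpha; elim/big_ind: _ => [|a b [G1 ? <-] [G2 ? <-]|G tf].
- exists (edgeless 'I_n); first exact: edgeless_triangle_free.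
  by rewrite max_stable_edgeless card_ord.
- case: (leqP (max_stable G1) (max_stable G2)) => h.
    by exists G1 => //; lia.
  by exists G2 => //; lia.
- by exists G.
Qed.

(* Main.v *)
(** Both parts rest on gluing extremal graphs [G1], [G2] for [n1], [n2].
    Deleting vertices [v1], [v2] and joining [N(v1)] completely to [N(v2)] keeps
    the graph triangle-free, and no maximum stable sets of [G1] and [G2] survive
    together, as each of them meets [N(vi)]: hence
    [alpha (n1 + n2 - 2) < alpha n1 + alpha n2].  At [ni = R(3, ai + 1) - 1] this reads
    [R(3, a1 + a2) >= R(3, a1 + 1) + R(3, a2 + 1) - 3], which leaves a slack of
    one in [R(3, a1 + a2) <= n1 + n2 <= R(3, a1 + 1) + R(3, a2 + 1) - 2].
    If moreover [ni >= 3], one can choose non-adjacent [ui], [vi] in [Gi], add a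
    twin [wi] of [vi], and join [v1] to [N(u2)], [w1] to [u2], [v2] to [N(u1)],
    [w2] to [u1]; this gives [alpha (n1 + n2 + 2) <= alpha n1 + alpha n2].
    Combining the two inequalities proves the strict inequality for three terms. *)
Require Import Defs.
From mathcomp Require Import all_boot zify.

Set Implicit Arguments.
Unset Strict Implicit.
Unset Printing Implicit Defensive.

(** * Stable sets, pullbacks and upper bounds for [alpha] *)

Lemma leq_max_stable (T : finType) (G : graph T) (S : {set T}) :
  stable G S -> #|S| <= max_stable G.
Proof. exact: (@leq_bigmax_cond _ _ (fun S : {set T} => #|S|)). Qed.

Lemma max_stableP (T : finType) (G : graph T) :
  exists2 S : {set T}, stable G S & #|S| = max_stable G.
Proof.
have st0 : stable G set0 by apply/stableP => x y; rewrite inE.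
have := eq_bigmax_cond (fun S : {set T} => #|S|).
by case/(_ (stable G)) => [|S stS eqS]; [apply/card_gt0P; exists set0 | exists S].
Qed.

Lemma triangle_freeP (T : finType) (G : graph T) :
  reflect (forall x y z, adj G x y -> adj G y z -> adj G x z -> False)
          (triangle_free G).
Proof.
apply: (iffP idP) => [/existsP tf x y z xy yz xz | tf].
  apply: tf; exists x; apply/existsP; exists y; apply/existsP; exists z.
  by rewrite xy yz xz.
apply/existsP => -[x /existsP[y /existsP[z /and3P[xy yz xz]]]].
exact: tf xy yz xz.
Qed.

Lemma stableU1 (T : finType) (G : graph T) (S : {set T}) x :
  stable G S -> {in S, forall y, adj G x y = false} -> stable G (x |: S).
Proof.
move=> /stableP stS xS; apply/stableP => y z.
rewrite !inE => /orP[/eqP->|yS] /orP[/eqP->|zS]; first exact: adj_irrefl.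
- exact: xS.
- by rewrite adj_sym xS.
- exact: stS.
Qed.

Lemma graph_of_rel (T : finType) (e : rel T) :
  irreflexive e -> symmetric e -> exists G : graph T, adj G =2 e.
Proof.
move=> e0 eC; pose f := [ffun p : T * T => e p.1 p.2].
have ax : [forall x, ~~ f (x, x)] && [forall x, forall y, f (x, y) == f (y, x)].
  apply/andP; split; apply/forallP => x; first by rewrite ffunE e0.
  by apply/forallP => y; rewrite !ffunE /= eC.
by exists (Graph ax) => x y; rewrite /adj /= ffunE.
Qed.

(** An injective [f] gives an induced subgraph; for other [f], vertices with the same image become
    twins. Both uses occur below. *)
Lemma pullback_graph (T U : finType) (f : U -> T) (G : graph T) :
  exists H : graph U, forall x y, adj H x y = adj G (f x) (f y).
Proof.
by apply: graph_of_rel => [x|x y]; [exact: adj_irrefl | exact: adj_sym].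
Qed.

Lemma pullback_triangle_free (T U : finType) (f : U -> T)
    (G : graph T) (H : graph U) :
  (forall x y, adj H x y = adj G (f x) (f y)) ->
  triangle_free G -> triangle_free H.
Proof.
move=> adjH /triangle_freeP tf; apply/triangle_freeP => x y z.
by rewrite !adjH; exact: tf.
Qed.

Lemma pullback_imset_stable (T U : finType) (f : U -> T)
    (G : graph T) (H : graph U) (S : {set U}) :
  (forall x y, adj H x y = adj G (f x) (f y)) ->
  stable H S -> stable G (f @: S).
Proof.
move=> adjH /stableP stS; apply/stableP => _ _ /imsetP[x xS ->] /imsetP[y yS ->].
by rewrite -adjH stS.
Qed.

(** Lets [alpha] be bounded by a graph on any finite type: [G] is pulled back along an injection of
    ['I_n] into [A]. *)
Lemma alpha_le (T : finType) (G : graph T) (A : {set T}) n k :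
  triangle_free G -> n <= #|A| ->
  (forall S : {set T}, S \subset A -> stable G S -> #|S| <= k) -> alpha n <= k.
Proof.
move=> tf nA hk.
pose f (i : 'I_n) : T := enum_val (widen_ord nA i).
have f_inj : injective f.
  by move=> i j /enum_val_inj/(congr1 val)/= /val_inj.
have [H adjH] := pullback_graph f G.
apply: leq_trans (proj2 (alphaP n) H (pullback_triangle_free adjH tf)) _.
have [S stS <-] := max_stableP H.
rewrite -(card_imset _ f_inj); apply: hk; last exact: pullback_imset_stable stS.
by apply/subsetP => _ /imsetP[i _ ->]; exact: enum_valP.
Qed.

Lemma alpha_leT (T : finType) (G : graph T) n :
  triangle_free G -> n <= #|T| -> alpha n <= max_stable G.
Proof.
rewrite -cardsT => tf nT; apply: (alpha_le tf nT) => S _; exact: leq_max_stable.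
Qed.

Lemma alpha_mono : {homo alpha : m n / m <= n}.
Proof.
move=> m n mn; have [[G tf <-] _] := alphaP n.
by apply: alpha_leT; rewrite ?card_ord.
Qed.

Lemma alpha_gt0 n : 0 < n -> 0 < alpha n.
Proof.
case: n => // n _; have [[G _ <-] _] := alphaP n.+1.
rewrite -(cards1 (ord0 : 'I_n.+1)); apply: leq_max_stable.
by apply/stableP => x y /set1P-> /set1P->; exact: adj_irrefl.
Qed.


(** Supplies the vertices [u] and [v] of the twin construction; this is where its size bounds
    enter. *)
Lemma nonadjacent_pair (T : finType) (G : graph T) :
  triangle_free G -> 2 < #|T| -> exists u v, u != v /\ adj G u v = false.
Proof.
move=> /triangle_freeP tf /card_gt2P[x [y [z [_ [xy yz zx]]]]].
case exy: (adj G x y); last by exists x, y.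
case eyz: (adj G y z); last by exists y, z.
case ezx: (adj G z x); last by exists z, x.
by case: (tf x y z) => //; rewrite adj_sym.
Qed.

(** * Ramsey numbers as thresholds of [alpha] *)

Lemma ramsey3_propE m N : ramsey3_prop m N = (m <= alpha N).
Proof.
apply/forallP/idP => [h | mN G].
  have [[G tf <-] _] := alphaP N; have := h G; rewrite (negbTE tf) /=.
  by case/existsP => S /andP[stS /eqP <-]; exact: leq_max_stable.
case: (boolP (has_triangle G)) => //= tf; apply/existsP.
have [S stS cS] := max_stableP G.
have : m <= #|S| by rewrite cS (leq_trans mN) // (proj2 (alphaP N)).
(* The Ramsey property asks for exactly [m] vertices, so a larger stable set is trimmed. *)
case/card_geqP => s [us ss sS]; exists [set x in s].
rewrite cardsE (card_uniqP us) ss eqxx andbT; apply: stable_sub stS.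
by apply/subsetP => x; rewrite inE => /sS.
Qed.

(** A Galois connection, by monotonicity of [alpha]; the final argument uses [R3] only through
    it. *)
Lemma leq_R3 m N : (R3 m <= N) = (m <= alpha N).
Proof.
rewrite /R3; case: ex_minnP => r; rewrite ramsey3_propE => mr min_r.
apply/idP/idP => [rN | mN]; first exact: leq_trans mr (alpha_mono rN).
by apply: min_r; rewrite ramsey3_propE.
Qed.

(** * Gluing two graphs along cross edges *)

Section Join.

Variables (T1 T2 : finType) (G1 : graph T1) (G2 : graph T2).
Variable c : T1 -> T2 -> bool.

Definition join_rel : rel (T1 + T2) := fun x y =>
  match x, y with
  | inl x, inl y => adj G1 x y
  | inl x, inr y => c x y
  | inr x, inl y => c y x
  | inr x, inr y => adj G2 x y
  end.

Lemma join_graph : exists G : graph (T1 + T2)%type, adj G =2 join_rel.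
Proof.
by apply: graph_of_rel => [[]|[x|x] [y|y]] //= *;
  rewrite ?adj_irrefl // adj_sym.
Qed.

Hypotheses (tf1 : triangle_free G1) (tf2 : triangle_free G2).
Hypothesis c1 : forall x y y', c x y -> c x y' -> adj G2 y y' = false.
Hypothesis c2 : forall y x x', c x y -> c x' y -> adj G1 x x' = false.

(** A triangle lies within one side or has an edge on one side whose ends share a cross neighbour;
    [c1] and [c2] exclude the latter. *)
Lemma join_triangle_free (G : graph (T1 + T2)%type) :
  adj G =2 join_rel -> triangle_free G.
Proof.
move=> adjG; apply/triangle_freeP => x y z; rewrite !adjG.
case: x y z => [x|x] [y|y] [z|z] /= h1 h2 h3.
- by move/triangle_freeP: tf1 => /(_ _ _ _ h1 h2).
- by rewrite (c2 h3 h2) in h1.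
- by rewrite (c2 h1 h2) in h3.
- by rewrite (c1 h1 h3) in h2.
- by rewrite (c2 h1 h3) in h2.
- by rewrite (c1 h1 h2) in h3.
- by rewrite (c1 h3 h2) in h1.
- by move/triangle_freeP: tf2 => /(_ _ _ _ h1 h2).
Qed.

End Join.

Lemma card_sum_set (T1 T2 : finType) (S : {set T1 + T2}) :
  #|S| = #|[set x | inl x \in S]| + #|[set y | inr y \in S]|.
Proof. by rewrite -!sum1dep_card -sum1_card big_sumType. Qed.

Lemma join_stable (T1 T2 : finType) (G1 : graph T1) (G2 : graph T2) c
    (G : graph (T1 + T2)%type) (S : {set T1 + T2}) :
  adj G =2 join_rel G1 G2 c -> stable G S ->
  [/\ stable G1 [set x | inl x \in S], stable G2 [set y | inr y \in S] &
      forall x y, inl x \in S -> inr y \in S -> c x y = false].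
Proof.
move=> adjG /stableP stS; split.
- by apply/stableP => x y; rewrite !inE => xS yS; have := stS _ _ xS yS; rewrite adjG.
- by apply/stableP => x y; rewrite !inE => xS yS; have := stS _ _ xS yS; rewrite adjG.
- by move=> x y xS yS; have := stS _ _ xS yS; rewrite adjG.
Qed.

(** * Deleting two vertices *)

Lemma nbhd_meets_max_stable (T : finType) (G : graph T) v (S : {set T}) :
  stable G S -> v \notin S -> max_stable G <= #|S| -> exists2 x, x \in S & adj G v x.
Proof.
move=> stS vS leS; apply/exists_inP; apply: contraLR leS => /exists_inPn h.
(* The [1] is read as the truth value of [v \notin S], so that [cardsU1] folds the sum into the size
   of [v |: S]. *)
rewrite -ltnNge -(add1n #|S|) -[1]/(true : nat) -vS -cardsU1.
by apply/leq_max_stable/stableU1 => // y /h/negbTE.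
Qed.

Lemma alpha_delete2 m1 m2 :
  alpha (m1 + m2) < alpha m1.+1 + alpha m2.+1.
Proof.
have [[G1 tf1 a1] _] := alphaP m1.+1; have [[G2 tf2 a2] _] := alphaP m2.+1.
pose v1 : 'I_m1.+1 := ord0; pose v2 : 'I_m2.+1 := ord0.
pose c x y := adj G1 v1 x && adj G2 v2 y.
have [G adjG] := join_graph G1 G2 c.
have tf : triangle_free G.
  apply: (join_triangle_free tf1 tf2 _ _ adjG) => [x y y'|y x x'].
    move=> /andP[_ vy] /andP[_ vy']; apply/negP => yy'.
    by move/triangle_freeP: tf2 => /(_ _ _ _ vy yy' vy').
  move=> /andP[vx _] /andP[vx' _]; apply/negP => xx'.
  by move/triangle_freeP: tf1 => /(_ _ _ _ vx xx' vx').
pose A := ~: [set inl v1; inr v2] : {set 'I_m1.+1 + 'I_m2.+1}.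
have cA : m1 + m2 <= #|A|.
  by rewrite cardsCs setCK cards2 card_sum !card_ord addSn addnS !subSS subn0.
have a1_gt0 := alpha_gt0 (ltn0Sn m1); have a2_gt0 := alpha_gt0 (ltn0Sn m2).
suff : alpha (m1 + m2) <= (alpha m1.+1 + alpha m2.+1).-1 by lia.
apply: (alpha_le tf cA) => S sSA /(join_stable adjG)[st1 st2 stc].
rewrite card_sum_set.
have le1 := leq_max_stable st1; have le2 := leq_max_stable st2.
(* If neither side falls short of its maximum, both meet the neighbourhoods of [v1] and [v2], and
   [S] contains a cross edge. *)
case: (ltnP #|[set x | inl x \in S]| (max_stable G1)) => h1; first by lia.
case: (ltnP #|[set y | inr y \in S]| (max_stable G2)) => h2; first by lia.
have nA x : x \in S -> x \in A by exact/subsetP.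
have [|x] := nbhd_meets_max_stable st1 (v := v1) _ h1.
  by rewrite inE; apply/negP => /nA; rewrite !inE eqxx.
rewrite inE => xS v1x; have [|y] := nbhd_meets_max_stable st2 (v := v2) _ h2.
  by rewrite inE; apply/negP => /nA; rewrite !inE eqxx orbT.
by rewrite inE => yS v2y; have := stc _ _ xS yS; rewrite /c v1x v2y.
Qed.

(** * Adding twins *)

Section Twin.

(* [H] is [G] with a twin of [v] added, the new vertex being [None]. *)
Variables (T : finType) (G : graph T) (v : T) (H : graph (option T)).
Hypothesis adjH : forall x y, adj H x y = adj G (odflt v x) (odflt v y).

(** Merging the twins by [odflt v] is injective on [S] unless [S] contains both; then [None] is
    removed first. *)
Lemma twin_stable_le (S : {set option T}) : stable H S ->
  #|S| <= max_stable G + ((None \in S) && (Some v \in S)).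
Proof.
have inj_le (S' : {set option T}) : stable H S' ->
    ~~ ((None \in S') && (Some v \in S')) -> #|S'| <= max_stable G.
  move=> stS' nS'; rewrite -(@card_in_imset _ _ (odflt v) S').
    exact/leq_max_stable/(pullback_imset_stable adjH).
  move=> [x|] [y|] //= xS yS; first by move=> ->.
  - by move=> xv; rewrite -xv xS yS in nS'.
  - by move=> vy; rewrite vy xS yS in nS'.
move=> stS; case: (boolP (_ && _)) => nS; last by rewrite addn0; exact: inj_le.
have [NS vS] := andP nS; rewrite (cardsD1 None S) NS addnC leq_add2r.
apply: inj_le; last by rewrite !inE eqxx.
by apply: stable_sub stS; exact: subsetDl.
Qed.

(** There is room to add [Some u] to [S], and as [u != v] this leaves the twin term unchanged. *)
Lemma twin_stable_lt u (S : {set option T}) :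
  u != v -> stable H S -> Some u \notin S ->
  {in S, forall x, adj H (Some u) x = false} ->
  #|S| < max_stable G + ((None \in S) && (Some v \in S)).
Proof.
move=> uv stS uS nuS; have := twin_stable_le (stableU1 stS nuS).
rewrite cardsU1 uS add1n !inE /=.
by rewrite (inj_eq Some_inj) (eq_sym v) (negbTE uv).
Qed.

End Twin.

(** If a stable set contains both twins of one side, say the first, then [Some v1] keeps it off the
    neighbours of [u2] and [None] keeps it off [u2], so its second part has room for [u2]. *)
Definition twin_join (T1 T2 : finType)
    (H1 : graph (option T1)) (u1 v1 : T1) (H2 : graph (option T2)) (u2 v2 : T2)
    (x : option T1) (y : option T2) : bool :=
  [|| (x == Some v1) && adj H2 (Some u2) y, (x == None) && (y == Some u2),
      (y == Some v2) && adj H1 (Some u1) x | (y == None) && (x == Some u1)].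

Lemma twin_joinC (T1 T2 : finType) (H1 : graph (option T1)) u1 v1
    (H2 : graph (option T2)) u2 v2 x y :
  twin_join H1 u1 v1 H2 u2 v2 x y = twin_join H2 u2 v2 H1 u1 v1 y x.
Proof. by rewrite /twin_join !orbA orbC [LHS]orbA orbC !orbA. Qed.

(** The cross neighbours of [Some v1] are the neighbours of [u2], a stable set; every other vertex
    has at most one cross neighbour. *)
Lemma twin_join_nonadj (T1 T2 : finType) (G1 : graph T1) (H1 : graph (option T1))
    u1 v1 (H2 : graph (option T2)) u2 v2 x y y' :
  (forall x y, adj H1 x y = adj G1 (odflt v1 x) (odflt v1 y)) ->
  u1 != v1 -> adj G1 u1 v1 = false -> triangle_free H2 ->
  twin_join H1 u1 v1 H2 u2 v2 x y -> twin_join H1 u1 v1 H2 u2 v2 x y' ->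
  adj H2 y y' = false.
Proof.
move=> adjH1 uv1 nuv1 /triangle_freeP tf2.
have nN : adj H1 (Some u1) None = false by rewrite adjH1.
have nv : adj H1 (Some u1) (Some v1) = false by rewrite adjH1.
rewrite /twin_join; case: (eqVneq x (Some v1)) => [->|_] /=.
  rewrite nv (inj_eq Some_inj) (eq_sym v1) (negbTE uv1) !andbF !orbF => uy uy'.
  by apply/negP => yy'; exact: tf2 uy yy' uy'.
case: x => [x|] /=; last first.
  by rewrite nN !andbF !orbF => /eqP-> /eqP->; exact: adj_irrefl.
case: (eqVneq (Some x) (Some u1)) => [->|_] /=.
  rewrite adj_irrefl !andbF !andbT /= => /eqP-> /eqP->; exact: adj_irrefl.
by rewrite !andbF !orbF => /andP[/eqP-> _] /andP[/eqP-> _]; exact: adj_irrefl.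
Qed.

Lemma alpha_add2 n1 n2 :
  2 < n1 -> 2 < n2 -> alpha (n1 + n2).+2 <= alpha n1 + alpha n2.
Proof.
move=> n1_gt2 n2_gt2.
have [[G1 tf1 <-] _] := alphaP n1; have [[G2 tf2 <-] _] := alphaP n2.
have [|u1 [v1 [uv1 nuv1]]] := nonadjacent_pair tf1; first by rewrite card_ord.
have [|u2 [v2 [uv2 nuv2]]] := nonadjacent_pair tf2; first by rewrite card_ord.
have [H1 adjH1] := pullback_graph (odflt v1) G1.
have [H2 adjH2] := pullback_graph (odflt v2) G2.
have tfH1 := pullback_triangle_free adjH1 tf1.
have tfH2 := pullback_triangle_free adjH2 tf2.
have [G adjG] := join_graph H1 H2 (twin_join H1 u1 v1 H2 u2 v2).
have tf : triangle_free G.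
  apply: (join_triangle_free tfH1 tfH2 _ _ adjG) => [x y y'|y x x'].
    exact: (twin_join_nonadj adjH1).
  by rewrite !(twin_joinC H1); exact: (twin_join_nonadj adjH2).
have cT : (n1 + n2).+2 <= #|[set: option 'I_n1 + option 'I_n2]|.
  by rewrite cardsT card_sum !card_option !card_ord; lia.
apply: (alpha_le tf cT) => S _ /(join_stable adjG)[st1 st2 stc].
rewrite card_sum_set; set S1 := [set x | _] in st1 *; set S2 := [set x | _] in st2 *.
have := twin_stable_le adjH1 st1; have := twin_stable_le adjH2 st2.
have lt1 : (None \in S2) && (Some v2 \in S2) ->
    #|S1| < max_stable G1 + ((None \in S1) && (Some v1 \in S1)).
  rewrite [None \in S2]inE [Some v2 \in S2]inE => /andP[N2 V2].
  apply: (twin_stable_lt adjH1 uv1 st1).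
    by rewrite inE; apply/negP => /stc/(_ N2); rewrite /twin_join !eqxx !orbT.
  move=> x; rewrite inE => /stc/(_ V2).
  by rewrite /twin_join eqxx => /norP[_ /norP[_ /norP[/negbTE]]].
have lt2 : (None \in S1) && (Some v1 \in S1) ->
    #|S2| < max_stable G2 + ((None \in S2) && (Some v2 \in S2)).
  rewrite [None \in S1]inE [Some v1 \in S1]inE => /andP[N1 V1].
  apply: (twin_stable_lt adjH2 uv2 st2).
    by rewrite inE; apply/negP => /(stc _ _ N1); rewrite /twin_join !eqxx !orbT.
  move=> x; rewrite inE => /(stc _ _ V1).
  by rewrite /twin_join eqxx => /norP[/negbTE].
(* The surplus of one from a twin pair on one side is paid for by the strict bound on the other. *)
move: lt1 lt2; move: #|S1| #|S2| => s1 s2.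
case: (_ && _); case: (_ && _) => /= lt1 lt2;
  rewrite ?addn0 ?addn1 ?ltnS in lt1 lt2 *; lia.
Qed.

Theorem theorem3p19 (n1 n2 n3 : nat)
    (n1_gt0 : 0 < n1) (n2_gt0 : 0 < n2) (n3_gt0 : 0 < n3) :
  (alpha (n1 + n2) = alpha n1 + alpha n2 ->
     exists e e1 e2 : nat,
       [/\ e <= 1, e1 <= 1 & e2 <= 1] /\
       e + e1 + e2 <= 1 /\
       [/\ is_ramsey_number (n1 + n2 - e),
           is_ramsey_number (n1 + 1 + e1)
         & is_ramsey_number (n2 + 1 + e2)])
  /\
  (3 <= n1 -> 3 <= n2 -> 3 <= n3 ->
     alpha (n1 + n2 + n3) < alpha n1 + alpha n2 + alpha n3).
Proof.
split=> [a12 | n1_ge3 n2_ge3 n3_ge3]; last first.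
  (* The two vertices gained by [alpha_add2] are spent in gluing orders [n1 + n2 + 2] and [n3]. *)
  have := alpha_delete2 (n1 + n2).+1 n3.-1.
  rewrite (prednK n3_gt0) addSn -addnS (prednK n3_gt0).
  by have := alpha_add2 n1_ge3 n2_ge3; lia.
have a1_gt0 := alpha_gt0 n1_gt0; have a2_gt0 := alpha_gt0 n2_gt0.
set a1 := alpha n1 in a12 a1_gt0 *; set a2 := alpha n2 in a12 a2_gt0 *.
have r12 : R3 (a1 + a2) <= n1 + n2 by rewrite leq_R3 a12.
have r1 : n1 < R3 a1.+1 by rewrite ltnNge leq_R3 -ltnNge.
have r2 : n2 < R3 a2.+1 by rewrite ltnNge leq_R3 -ltnNge.
(* The gluing is applied at the largest orders with [alpha] at most [a1] and [a2]. *)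
have b1 : alpha (R3 a1.+1).-1 <= a1 by rewrite -ltnS ltnNge -leq_R3; lia.
have b2 : alpha (R3 a2.+1).-1 <= a2 by rewrite -ltnS ltnNge -leq_R3; lia.
have r12_gt : (R3 a1.+1).-2 + (R3 a2.+1).-2 < R3 (a1 + a2).
  rewrite ltnNge leq_R3 -ltnNge; apply: leq_trans (alpha_delete2 _ _) _.
  by rewrite !prednK ?leq_add //; lia.
(* By [r12], [r1] and [r2] no subtraction truncates; the three sum to
   [R3 a1.+1 + R3 a2.+1 - 2 - R3 (a1 + a2)], at most 1 by [r12_gt]. *)
exists (n1 + n2 - R3 (a1 + a2)), (R3 a1.+1 - n1.+1), (R3 a2.+1 - n2.+1).
split; [by split; lia | split; first by lia].
split; [exists (a1 + a2) | exists a1.+1 | exists a2.+1]; lia.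
Qed.
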